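(* Let $n\ge2$ and let $\mathbf P$ be the uniform probability measure on the set $S_n$ of permutations of $[n]=\{1,\dots,n\}$. For any probability vector $(\theta_A)_{A\subset[n]}$, $$\forall f\in L\log L,\qquad \theta_{\star\star}\,\mathrm{Ent}(f)\le\sum_{A\subset[n]}\theta_A\,\mathbf E[\mathrm{Ent}_A(f)],$$ where $\theta_{\star\star}:=\min_{1\le i<j\le n}\ \sum_{A\supset\{i,j\}}\theta_A$.
   Context: A permutation $\sigma\in S_n$ is identified with the configuration $(\sigma_i)_{i\in[n]}$. $\mathbf E$ is expectation under $\mathbf P$; here $L\log L$ is simply the set of functions $f:S_n\to\mathbb R_+$; $\mathrm{Ent}(f)=\mathbf E[f\log f]-\mathbf E[f]\log\mathbf E[f]$. For $A\subset[n]$ with complement $A^c=[n]\setminus A$, $\mathbf E_A[f]=\mathbf E[f\mid\sigma_j,\ j\in A^c]$ and $\mathrm{Ent}_A(f)=\mathbf E_A[f\log f]-\mathbf E_A[f]\log\mathbf E_A[f]$. *)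

(* Defs.v *)
From mathcomp Require Import all_boot all_order all_algebra all_fingroup.
From mathcomp Require Import reals exp.

Set Implicit Arguments.
Unset Strict Implicit.
Unset Printing Implicit Defensive.

Import Order.TTheory GRing.Theory Num.Theory.

Local Open Scope ring_scope.

(* [n] is rendered as 'I_n = {0, ..., n-1}; s : 'S_n is the configuration
   (s i) indexed by i : 'I_n. *)

Section UniformPermutations.
Variables (R : realType) (n : nat).
Implicit Types (f : 'S_n -> R) (A : {set 'I_n}) (B : {set 'S_n}) (s t : 'S_n).

Definition unif_mass s : R := #|{: 'S_n}|%:R^-1.

Definition unif_prob B : R := \sum_(s in B) unif_mass s.

Definition expect f : R := \sum_s unif_mass s * f s.

(* ln 0 = 0 in the library, which gives the convention 0 log 0 = 0. *)
Definition ent f : R :=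
  expect (fun s => f s * ln (f s)) - expect f * ln (expect f).

(* The atom containing s of the sigma-algebra generated by the coordinates
   outside A. *)
Definition atom A s : {set 'S_n} := [set t : 'S_n | [forall j in ~: A, t j == s j]].

(* A version of E[f | s_j, j in A^c], as a function of s.  Every atom has
   positive probability (s belongs to atom A s), so this is the only version. *)
Definition cond_expect A f s : R :=
  (\sum_(t in atom A s) unif_mass t * f t) / unif_prob (atom A s).

Definition cond_ent A f s : R :=
  cond_expect A (fun t => f t * ln (f t)) s
  - cond_expect A f s * ln (cond_expect A f s).

End UniformPermutations.

Section Weights.
Variables (R : realType) (n : nat).
Implicit Types theta : {set 'I_n} -> R.

Definition probability_vector theta : Prop :=
  (forall A, 0 <= theta A) /\ \sum_A theta A = 1.

Definition pair_weight theta (i j : 'I_n) : R :=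
  \sum_(A : {set 'I_n} | [set i; j] \subset A) theta A.

(* The default value of the iterated minimum is the total weight, which bounds
   every pair weight from above when theta is nonnegative; so for n >= 2 it
   does not affect the minimum. *)
Definition theta_star_star theta : R :=
  \big[Num.min/(\sum_A theta A)]_(p : 'I_n * 'I_n | (p.1 < p.2)%N)
    pair_weight theta p.1 p.2.

End Weights.

(* Main.v *)
Require Import Defs.
From mathcomp Require Import boolp functions topology normedtype derive realfun.
From mathcomp Require Import all_boot all_order all_algebra all_fingroup.
From mathcomp Require Import ring lra.
From mathcomp Require Import reals exp.

(** Write phi(x) = x ln x and U(A) = E[Ent_A(f)].  By the tower property
    U(A) = E[phi(f)] - E[phi(E_A f)], and Ent(f) = U([n]).  For weights
    theta >= 0 and a constant c with c <= sum_(A containing i, j) theta_A for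
    all i <> j, the inequality
      c U(B) <= sum_A theta_A U(A cap B)
    is proved for every block B, by induction on #|B| (lemma
    block_ent_factorization_gt0); the theorem is the case B = [n],
    c = theta_star_star.

    Induction step.  Apply the induction hypothesis to the blocks B minus l,
    l in B, and add up.  What is left to prove is c V(B) <= sum_A theta_A
    V(A cap B), where V(A) = sum_(l in A) (U(A) - U(A minus l)) collects the
    entropies of the conditional means given the outside of A and one more
    coordinate.  Read V(A) by values rather than by positions
    (block_ent_chain): a value x occupying the block sits at a uniform position
    of A, and V(A) is the mean of
      F_A(h) = sum_(l in A) phi(h_l) - #|A| phi(avg_A h)
    where h_l is the conditional mean of f given the configuration outside A
    and sigma_l = x.  The function F_A is convex and homogeneous, so averaging
    the profile h over what happens inside a larger block B, with x held fixed,
    only decreases F_A (set_ent_profile_le); after averaging, all the blocks A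
    contained in B see the same profile, that of B.  The step thus reduces to a
    statement about one positive function h on a finite set,
      c F_B(h) <= sum_A theta_A F_(A cap B)(h)      (set_ent_block).

    One function.  Let h relax linearly to its mean b over B.  At the end of
    the flow all F_A vanish, so it suffices to compare the rates of decrease,
    which are, up to a common factor, D_A(h) = sum_(i in A) (h_i - b)
    (ln h_i - ln avg_A h).  With p_ij = (h_i - h_j)(ln h_i - ln h_j) >= 0,
      2 #|B| D_A(h) >= sum_(i, j in A) p_ij   for A contained in B,
    with equality for A = B (dissipation_ge, sum_pair_dissipation).  The
    right-hand side is additive over pairs, so the hypothesis on theta, which
    is itself about pairs, compares the two sides term by term
    (dissipation_block).

    All this is done for f > 0; since phi is continuous on the whole line, the
    case f >= 0 follows by adding a constant to f and letting it tend to 0. *)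

Set Implicit Arguments.
Unset Strict Implicit.
Unset Printing Implicit Defensive.

Import Order.TTheory GRing.Theory Num.Theory.
Import numFieldNormedType.Exports.
Local Open Scope ring_scope.

(** * Entropy on a finite set and its dissipation *)

Section OneParticle.
Variables (R : realType) (I : finType).
Implicit Types (A B : {set I}) (h g : I -> R).

Definition xlnx (x : R) : R := x * ln x.

Definition avg A h : R := (\sum_(i in A) h i) / #|A|%:R.

(** The entropy of [h] under the uniform law on [A], multiplied by [#|A|].
    The factor #|A| is the one that the recursion on permutations produces: a
    value lies in a block of positions with probability proportional to its
    size. *)
Definition set_ent A h : R :=
  \sum_(i in A) xlnx (h i) - #|A|%:R * xlnx (avg A h).

Lemma set_ent0 h : set_ent set0 h = 0.
Proof. by rewrite /set_ent big_set0 cards0 mul0r subrr. Qed.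

Lemma eq_set_ent A h g :
  {in A, h =1 g} -> set_ent A h = set_ent A g.
Proof.
move=> E; rewrite /set_ent /avg; congr (_ - _ * xlnx (_ / _)).
  by apply: eq_bigr => i iA; rewrite E.
exact: eq_bigr.
Qed.

Lemma ln_le_subr1 (x : R) : 0 < x -> ln x <= x - 1.
Proof.
by move=> x0; rewrite -{1}(subrKC 1 x); apply: le_ln1Dx; lra.
Qed.

(** This is ln z <= z - 1 at z = (y / b) / (x / a).  The correction
    x - y (a / b) is kept because it cancels when x and y are summed over a set
    on which they have means a and b. *)
Lemma mul_ln_ratio_le (x y a b : R) : 0 < x -> 0 < y -> 0 < a -> 0 < b ->
  x * (ln y - ln b) + (x - y * (a / b)) <= x * (ln x - ln a).
Proof.
move=> x0 y0 a0 b0.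
have n0 : 0 < y * a by rewrite mulr_gt0.
have d0 : 0 < b * x by rewrite mulr_gt0.
have := ln_le_subr1 (divr_gt0 n0 d0).
rewrite ln_div ?posrE // !lnM ?posrE // => /(ler_wpM2l (ltW x0)).
have -> : x * (y * a / (b * x) - 1) = y * (a / b) - x.
  by field; rewrite !gt_eqF.
nra.
Qed.

Lemma card_gt0R A : A != set0 -> 0 < #|A|%:R :> R.
Proof. by move=> A0; rewrite ltr0n card_gt0. Qed.

Lemma avgK A h : A != set0 -> #|A|%:R * avg A h = \sum_(i in A) h i.
Proof.
by move=> /card_gt0R A0; rewrite /avg mulrCA divff ?mulr1 // gt_eqF.
Qed.

Lemma avg_gt0 A h : (forall i, 0 < h i) -> A != set0 -> 0 < avg A h.
Proof.
move=> h0 A0; rewrite divr_gt0 ?card_gt0R //.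
have /set0Pn[i iA] := A0.
rewrite (bigD1 i) //=; apply: ltr_wpDr => //.
by apply: sumr_ge0 => j _; apply: ltW.
Qed.

Lemma set_entE A h : A != set0 ->
  set_ent A h = \sum_(i in A) h i * (ln (h i) - ln (avg A h)).
Proof.
move=> A0; rewrite /set_ent /xlnx mulrA avgK //.
under [RHS]eq_bigr do rewrite mulrBr.
by rewrite sumrB mulr_suml.
Qed.

(** The entropy is convex and homogeneous of degree one in the function, so its
    tangent hyperplane at [g] passes through the origin: the bound is linear in
    [h], with no constant term, and its coefficients are the partial derivatives
    at [g]. *)
Lemma set_ent_tangent A h g :
  (forall i, 0 < h i) -> (forall i, 0 < g i) -> A != set0 ->
  \sum_(i in A) h i * (ln (g i) - ln (avg A g)) <= set_ent A h.
Proof.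
move=> h0 g0 A0; rewrite set_entE //.
have ah := avg_gt0 h0 A0; have ag := avg_gt0 g0 A0.
have key i := mul_ln_ratio_le (h0 i) (g0 i) ah ag.
apply: le_trans (ler_sum _ (fun i _ => key i)).
rewrite big_split /= lerDl sumrB -mulr_suml -!avgK //.
rewrite -mulrA [avg A g * _]mulrC divfK ?gt_eqF //.
by rewrite subrr.
Qed.

(** The speed at which [set_ent A] decreases when every [g i] moves towards [M]
    with velocity [M - g i]. *)
Definition dissipation A (M : R) g : R :=
  \sum_(i in A) (g i - M) * (ln (g i) - ln (avg A g)).

Definition pair_dissipation g i j : R := (g i - g j) * (ln (g i) - ln (g j)).

Lemma pair_dissipation_ge0 g i j :
  (forall i, 0 < g i) -> 0 <= pair_dissipation g i j.
Proof.
move=> g0; rewrite /pair_dissipation; have [le|/ltW le] := leP (g i) (g j).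
  by rewrite mulr_le0 ?subr_le0 // ler_ln ?posrE.
by rewrite mulr_ge0 ?subr_ge0 // ler_ln ?posrE.
Qed.

Lemma sum_pair_dissipation A g : A != set0 ->
  \sum_(i in A) \sum_(j in A) pair_dissipation g i j =
  (2 * #|A|%:R) * dissipation A (avg A g) g.
Proof.
move=> A0; set a := avg A g; set l := fun i => ln (g i) - ln a.
have E i j : pair_dissipation g i j =
   g i * l i + g j * l j - g i * l j - l i * g j.
  by rewrite /pair_dissipation /l; ring.
have -> : dissipation A a g = \sum_(i in A) (g i - a) * l i by [].
clearbody l; under eq_bigr do under eq_bigr do rewrite E.
have inner i : \sum_(j in A) (g i * l i + g j * l j - g i * l j - l i * g j) =
   #|A|%:R * (g i * l i) + \sum_(j in A) g j * l j
   - g i * (\sum_(j in A) l j) - l i * (\sum_(j in A) g j).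
  by rewrite !sumrB big_split /= sumr_const mulr_natl -!mulr_sumr.
under eq_bigr do rewrite inner.
under [in RHS]eq_bigr do rewrite mulrBl.
rewrite !sumrB big_split /= sumr_const -!mulr_sumr -!mulr_suml -(avgK g A0) -/a.
by rewrite -mulr_natl; ring.
Qed.

(** The pairs in [A] account for #|A| times the dissipation towards the mean of
    [A].  That dissipation is the entropy of [g] on [A] plus a nonnegative
    multiple of the mean.  Passing to the factor #|B| and to the mean over [B]
    increases both parts: #|B| is at least #|A|, and, [g] being positive, the
    total mass #|B| avg B g is at least #|A| avg A g. *)
Lemma dissipation_ge A B g : (forall i, 0 < g i) -> A \subset B ->
  \sum_(i in A) \sum_(j in A) pair_dissipation g i j <=
  (2 * #|B|%:R) * dissipation A (avg B g) g.
Proof.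
move=> g0 AB; have [->|A0] := eqVneq A set0.
  by rewrite /dissipation !big_set0 mulr0.
have B0 : B != set0 by apply: contraNneq A0 => B0; rewrite -subset0 -B0.
rewrite sum_pair_dissipation // -!mulrA ler_pM2l //.
have ha := avg_gt0 g0 A0; have hb := avg_gt0 g0 B0.
have mA := card_gt0R A0.
have mAB : #|A|%:R <= #|B|%:R :> R by rewrite ler_nat subset_leq_card.
have sAB : #|A|%:R * avg A g <= #|B|%:R * avg B g.
  rewrite !avgK // [leRHS](big_setID A) /= (setIidPr AB) lerDl.
  by apply: sumr_ge0 => i _; apply: ltW.
set a := avg A g in ha sAB *; set b := avg B g in hb sAB *.
set l := fun i => ln (g i) - ln a.
have DE M : dissipation A M g = \sum_(i in A) g i * l i - M * \sum_(i in A) l i.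
  by rewrite mulr_sumr -sumrB; apply: eq_bigr => i _; rewrite -mulrBl.
have avg1 : avg A (fun=> 1 : R) = 1.
  by rewrite /avg sumr_const -mulr_natl mulr1 divff // gt_eqF.
(* The tangent inequality between g and the constant 1, used in both
   directions, gives the two signs. *)
have P0 : 0 <= \sum_(i in A) g i * l i.
  have := @set_ent_tangent A g (fun=> 1) g0 (fun=> ltr01) A0.
  rewrite set_entE // -/a /l; apply: le_trans.
  by rewrite avg1 subrr big1 // => i _; rewrite mulr0.
have Q0 : \sum_(i in A) l i <= 0.
  have := @set_ent_tangent A (fun=> 1) g (fun=> ltr01) g0 A0.
  rewrite set_entE // -/a /l.
  rewrite avg1 ln1 subrr; under eq_bigr do rewrite mul1r.
  by move=> /le_trans; apply; rewrite big1 // => i _; rewrite mulr0.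
(* The pairs in A add up to 2 #|A| (P - a Q), where P >= 0 >= Q are the two
   sums above, and 2 #|B| (dissipation A b g) is 2 #|B| (P - b Q): only
   #|A| <= #|B| and #|A| a <= #|B| b are needed. *)
rewrite !DE; nra.
Qed.

(** For [B] itself the dissipation is exactly a sum over pairs, and for the sets
    [A :&: B] it is at least the sum over the pairs that they contain.
    Exchanging the sums, a pair [i != j] has weight [c] on the left, and on the
    right the total weight of the sets containing it; diagonal pairs vanish. *)
Lemma dissipation_block (c : R) (theta : {set I} -> R) B g :
  (forall A, 0 <= theta A) ->
  (forall i j, i != j ->
     c <= \sum_(A : {set I} | [set i; j] \subset A) theta A) ->
  (forall i, 0 < g i) ->
  c * dissipation B (avg B g) g <=
    \sum_A theta A * dissipation (A :&: B) (avg B g) g.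
Proof.
move=> t0 ct g0; have [->|B0] := eqVneq B set0.
  rewrite {1}/dissipation big_set0 mulr0 big1 // => A _.
  by rewrite setI0 /dissipation big_set0 mulr0.
have k0 : 0 < 2 * #|B|%:R :> R by rewrite mulr_gt0 ?card_gt0R.
rewrite -(ler_pM2l k0) mulrCA -sum_pair_dissipation // [leRHS]mulr_sumr.
pose pairs A := \sum_(i in A) \sum_(j in A) pair_dissipation g i j.
have le1 : \sum_A theta A * pairs (A :&: B)
   <= \sum_A 2 * #|B|%:R * (theta A * dissipation (A :&: B) (avg B g) g).
  apply: ler_sum => A _; rewrite mulrCA ler_wpM2l //.
  by rewrite dissipation_ge // subsetIr.
apply: le_trans le1.
have E A : theta A * pairs (A :&: B) =
   \sum_(i in B) \sum_(j in B)
       (if [set i; j] \subset A then theta A * pair_dissipation g i j else 0).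
  rewrite mulr_sumr [LHS](eq_bigl (fun i => (i \in B) && (i \in A))) /=;
    last first.
    by move=> i; rewrite !inE andbC.
  rewrite big_mkcondr /=; apply: eq_bigr => i iB.
  case: ifP => iA; last first.
    by rewrite big1 // => j _; rewrite subUset sub1set iA.
  rewrite mulr_sumr [LHS](eq_bigl (fun j => (j \in B) && (j \in A))) /=;
    last first.
    by move=> j; rewrite !inE andbC.
  rewrite big_mkcondr /=; apply: eq_bigr => j jB.
  by rewrite subUset !sub1set iA.
under [leRHS]eq_bigr do rewrite E.
rewrite [leRHS]exchange_big [leLHS]mulr_sumr /=; apply: ler_sum => i iB.
rewrite [leRHS]exchange_big [leLHS]mulr_sumr /=; apply: ler_sum => j jB.
have [->|ij] := eqVneq i j.
  rewrite /pair_dissipation subrr mul0r mulr0.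
  by apply: sumr_ge0 => A _; case: ifP => _; rewrite ?mulr0.
by rewrite -big_mkcond -mulr_suml ler_wpM2r ?ct // pair_dissipation_ge0.
Qed.

End OneParticle.

(** * Relaxation to the mean and continuity of x ln x *)

Section Flow.
Variables (R : realType) (I : finType).
Implicit Types (A B : {set I}) (h g : I -> R) (M s : R).

Lemma is_derive_bigsum (J : finType) (P : pred J) (u : J -> R -> R)
    (du : J -> R) (x : R) :
  (forall j, P j -> is_derive x (1 : R) (u j) (du j)) ->
  is_derive x (1 : R) (fun s => \sum_(j | P j) u j s) (\sum_(j | P j) du j).
Proof.
move=> H.
have -> : (fun s => \sum_(j | P j) u j s) = \sum_(j | P j) u j.
  by apply/funext => s; rewrite fct_sumE.
elim/big_ind2 : _ => // [|*]; [exact: is_derive_cst|exact: is_deriveD].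
Qed.

Lemma is_derive_scale (x k d : R) (u : R -> R) :
  is_derive x (1 : R) u d -> is_derive x (1 : R) (fun s => k * u s) (k * d).
Proof.
move=> H.
by have := is_deriveZ k H.
Qed.

Lemma is_derive_xlnx_affine (a b s : R) : 0 < a + s * b ->
  is_derive s (1 : R) (fun s => xlnx (a + s * b)) (b * (ln (a + s * b) + 1)).
Proof.
move=> p0.
have daff : is_derive s (1 : R) (fun s => a + s * b) b.
  have -> : (fun s => a + s * b) = cst a + (fun s => b * s).
    by apply/funext => t /=; rewrite mulrC.
  have := is_deriveD (is_derive_cst a s 1)
    (is_derive_scale b (is_derive_id s 1)).
  by rewrite add0r mulr1.
have dln := is_derive1_ln p0.
have dcomp := @is_derive1_comp R (@ln R) (fun s => a + s * b) s _ _ dln daff.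
have := @is_deriveM R _ _ _ s (1 : R) _ _ daff dcomp.
move=> H; apply: (is_derive_eq H).
rewrite /= /GRing.scale /=; field; rewrite gt_eqF //.
Qed.

Definition flow h (M s : R) i : R := h i + s * (M - h i).

Lemma avg_flow A h M s : A != set0 ->
  avg A (flow h M s) = avg A h + s * (M - avg A h).
Proof.
move=> A0; have k0 := card_gt0R R A0.
rewrite /avg /flow big_split /= -mulr_sumr sumrB sumr_const -mulr_natl.
by field; rewrite gt_eqF.
Qed.

Lemma flow_gt0 h M s i : (forall i, 0 < h i) -> 0 < M -> 0 <= s <= 1 ->
  0 < flow h M s i.
Proof. by move=> /(_ i) hi M0 /andP[s0 s1]; rewrite /flow; nra. Qed.

Lemma is_derive_set_ent_flow A h M s :
  (forall i, 0 < h i) -> 0 < M -> 0 <= s <= 1 ->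
  is_derive s (1 : R) (fun s => set_ent A (flow h M s))
   (\sum_(i in A) (M - h i) * (ln (flow h M s i) - ln (avg A (flow h M s)))).
Proof.
move=> h0 M0 s01; have [->|A0] := eqVneq A set0.
  rewrite big_set0.
  have -> : (fun s => set_ent set0 (flow h M s)) = cst 0.
    by apply/funext => t; rewrite set_ent0.
  exact: is_derive_cst.
have -> : (fun s => set_ent A (flow h M s)) =
   (fun s => \sum_(i in A) xlnx (h i + s * (M - h i))) -
   (fun s => #|A|%:R * xlnx (avg A h + s * (M - avg A h))).
  by apply/funext => t; rewrite /set_ent avg_flow.
have f0 i := flow_gt0 i h0 M0 s01.
have a0 := avg_gt0 f0 A0; rewrite avg_flow // in a0 *.
have H1 : is_derive s (1 : R)
   (fun s => \sum_(i in A) xlnx (h i + s * (M - h i)))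
   (\sum_(i in A) (M - h i) * (ln (flow h M s i) + 1)).
  by apply: is_derive_bigsum => i _; apply: is_derive_xlnx_affine; apply: f0.
have H2 := is_derive_scale #|A|%:R (is_derive_xlnx_affine a0).
apply: (is_derive_eq (is_deriveB H1 H2)).
set L := ln (avg A h + _).
have -> : #|A|%:R * ((M - avg A h) * (L + 1)) =
   \sum_(i in A) (M - h i) * (L + 1).
  rewrite -mulr_suml sumrB sumr_const -(avgK h A0) -mulr_natl; ring.
rewrite -sumrB; apply: eq_bigr => i _; ring.
Qed.

(** Along the flow towards the mean over [B], the difference of the two sides
    decreases by [dissipation_block], and it vanishes at time 1, when the
    function is constant on [B]. *)
Lemma set_ent_block (c : R) (theta : {set I} -> R) B h :
  (forall A, 0 <= theta A) ->
  (forall i j, i != j ->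
     c <= \sum_(A : {set I} | [set i; j] \subset A) theta A) ->
  (forall i, 0 < h i) ->
  c * set_ent B h <= \sum_A theta A * set_ent (A :&: B) h.
Proof.
move=> t0 ct h0; have [->|B0] := eqVneq B set0.
  by rewrite set_ent0 mulr0 big1 // => A _; rewrite setI0 set_ent0 mulr0.
set M := avg B h; have M0 : 0 < M := avg_gt0 h0 B0.
pose psi s := \sum_A theta A * set_ent (A :&: B) (flow h M s)
              - c * set_ent B (flow h M s).
pose D A s := \sum_(i in A) (M - h i) *
  (ln (flow h M s i) - ln (avg A (flow h M s))).
have dpsi s : 0 <= s <= 1 ->
    is_derive s (1 : R) psi (\sum_A theta A * D (A :&: B) s - c * D B s).
  move=> s01; apply: is_deriveB; last first.
    exact/is_derive_scale/is_derive_set_ent_flow.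
  apply: is_derive_bigsum => A _.
  exact/is_derive_scale/is_derive_set_ent_flow.
(* The flow preserves the mean over B, and M - flow h M s i = (1 - s) (M - h i);
   hence the factor 1 - s. *)
have DE A s :
    (1 - s) * D A s = - dissipation A (avg B (flow h M s)) (flow h M s).
  rewrite avg_flow // -/M subrr mulr0 addr0 /dissipation -sumrN mulr_sumr.
  by apply: eq_bigr => i _; rewrite {3}/flow; ring.
have dle0 s : 0 <= s < 1 -> \sum_A theta A * D (A :&: B) s - c * D B s <= 0.
  move=> /andP[s0 s1]; have s1' : 0 < 1 - s by rewrite subr_gt0.
  rewrite -(ler_pM2l s1') mulr0 mulrBr mulr_sumr.
  under eq_bigr do rewrite mulrCA DE mulrN.
  rewrite mulrCA DE mulrN opprK sumrN addrC subr_le0.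
  apply: dissipation_block => // i; apply: flow_gt0 => //.
  by rewrite s0 ltW.
have psi1 : psi 1 = 0.
  have E A : A \subset B -> set_ent A (flow h M 1) = 0.
    move=> AB; have [->|A0] := eqVneq A set0; first by rewrite set_ent0.
    rewrite /set_ent avg_flow // !mul1r.
    under eq_bigr do rewrite /flow mul1r subrKC.
    by rewrite sumr_const subrKC mulr_natl subrr.
  rewrite /psi (E _ (subxx _)) mulr0 subr0 big1 // => A _.
  by rewrite E ?mulr0 // subsetIr.
have psi0 : psi 0 = \sum_A theta A * set_ent (A :&: B) h - c * set_ent B h.
  have E : flow h M 0 = h by apply/funext => i; rewrite /flow mul0r addr0.
  by rewrite /psi E.
suff : psi 1 <= psi 0 by rewrite psi1 psi0 subr_ge0.
apply: (@ler0_derive1_nincr R psi 0 1) => //.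
- move=> x; rewrite in_itv /= => /andP[x0 x1].
  have x01 : 0 <= x <= 1 by rewrite (ltW x0) (ltW x1).
  by have [] := dpsi x x01.
- move=> x; rewrite in_itv /= => /andP[x0 x1].
  rewrite derive1E.
  have x01 : 0 <= x <= 1 by rewrite (ltW x0) (ltW x1).
  have [_ ->] := dpsi x x01.
  by apply: dle0; rewrite (ltW x0).
- apply: derivable_within_continuous => x; rewrite in_itv /= => x01.
  by have [] := dpsi x x01.
Qed.

(** Apply ln z <= z - 1 to z = 1 / sqrt x. *)
Lemma xlnx_abs_le (x : R) : 0 < x <= 1 -> `|xlnx x| <= 2 * Num.sqrt x.
Proof.
move=> /andP[x0 x1]; set y := Num.sqrt x.
have y0 : 0 < y by rewrite sqrtr_gt0.
have xE : x = y * y by rewrite -expr2 sqr_sqrtr // ltW.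
have lnx0 : ln x <= 0 by rewrite ln_le0.
have lnV_le : - ln y <= y^-1 - 1.
  by rewrite -lnV ?posrE // ln_le_subr1 ?invr_gt0.
rewrite /xlnx normrM gtr0_norm // ler0_norm //.
have -> : - ln x = 2 * - ln y by rewrite xE lnM ?posrE //; ring.
have e : y * y^-1 = 1 by rewrite divff // gt_eqF.
have : y * y * - ln y <= y * y * (y^-1 - 1) by rewrite ler_pM2l // mulr_gt0.
rewrite xE; nra.
Qed.

(** Since [ln] vanishes on the nonpositive reals, so does [xlnx], and the only
    delicate point is 0, where x ln x = O(sqrt x). *)
Lemma continuous_xlnx : continuous (@xlnx R).
Proof.
move=> x; have [x0|x0|->] := ltgtP x 0.
- apply: (@near_cst_continuous _ _ 0).
  near=> z; rewrite /xlnx ln0 ?mulr0 //; apply: ltW.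
  by near: z; exact: lt_nbhsl.
- by apply: continuousM => //; exact: continuous_ln.
- have xlnx0 : @xlnx R 0 = 0 by rewrite /xlnx mul0r.
  rewrite /continuous_at xlnx0; apply/cvgrPdist_le => /= e e0.
  near=> z.
  have [z0|z0] := leP z 0.
    by rewrite /xlnx ln0 // mulr0 subrr normr0 ltW.
  have z1 : z <= 1.
    by apply: ltW; near: z; apply: lt_nbhsl; exact: ltr01.
  have ze : z <= (e / 2) ^+ 2.
    by apply: ltW; near: z; apply: lt_nbhsl; rewrite exprn_gt0 // divr_gt0.
  rewrite sub0r normrN; apply: (le_trans (xlnx_abs_le _)); first by rewrite z0.
  have e2 : 0 < e / 2 by rewrite divr_gt0.
  have : Num.sqrt z <= Num.sqrt ((e / 2) ^+ 2) by rewrite ler_wsqrtr.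
  by rewrite sqrtr_sqr gtr0_norm //; lra.
Unshelve. all: by end_near. Qed.

End Flow.

(** * Conditional expectations on the symmetric group and the recursion *)

Section Permutations.
Variables (R : realType) (n : nat).
Implicit Types (f u w : 'S_n -> R) (A B C : {set 'I_n}) (s t p q : 'S_n).

Lemma mem_atom A s t : (t \in atom A s) = ((t * s^-1)%g \in Sym A).
Proof.
rewrite !inE; apply/forall_inP/subsetP => [H i|H i].
  rewrite !inE permM; apply: contraR => iA.
  by rewrite (eqP (H i _)) ?inE // permK.
rewrite inE => iA; apply: contraR iA => ts; apply: H.
by rewrite inE permM (can2_eq (permKV s) (permK s)).
Qed.

(** Products of permutations compose from left to right, [(p * s) i = s (p i)],
    so left multiplication permutes positions.  The atom of [s] is therefore
    the coset of [s] under the permutations supported in [A], which turns every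
    property of conditional expectations into a reindexing in a group. *)
Lemma cond_expectE A f s :
  cond_expect A f s = (#|A|)`!%:R^-1 * \sum_(p in Sym A) f (p * s)%g.
Proof.
have shift (g : 'S_n -> R) :
    \sum_(t in atom A s) g t = \sum_(p in Sym A) g (p * s)%g.
  rewrite (reindex_inj (mulIg s)); apply: eq_bigl => p /=.
  by rewrite mem_atom mulgK.
have N0 : (#|{: 'S_n}|%:R : R) != 0.
  by rewrite pnatr_eq0 -lt0n; apply/card_gt0P; exists 1%g.
have A0 : ((#|A|)`!%:R : R) != 0 by rewrite pnatr_eq0 -lt0n fact_gt0.
rewrite /cond_expect /unif_prob !shift /unif_mass.
rewrite sumr_const card_Sym -mulr_sumr -[X in _ / X]mulr_natr.
by field; rewrite N0 A0.
Qed.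

Lemma cond_expect_gt0 A f s : (forall t, 0 < f t) -> 0 < cond_expect A f s.
Proof.
move=> f0; rewrite cond_expectE mulr_gt0 ?invr_gt0 ?ltr0n ?fact_gt0 //.
rewrite (bigD1 1%g) ?group1 //=; apply: ltr_wpDr => //.
by apply: sumr_ge0 => p _; apply: ltW.
Qed.

Lemma cond_expect_shift A f q s :
  q \in Sym A -> cond_expect A f (q * s)%g = cond_expect A f s.
Proof.
move=> qA; rewrite !cond_expectE; congr (_ * _).
rewrite [RHS](reindex_inj (mulIg q)); apply: eq_big => p /=.
  by rewrite groupMr.
by rewrite mulgA.
Qed.

Lemma subset_Sym C A : C \subset A -> Sym C \subset Sym A.
Proof.
by move=> CA; apply/subsetP => p; rewrite !inE => /subset_trans; apply.
Qed.

Lemma cond_expect_const A (x : R) s : cond_expect A (fun=> x) s = x.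
Proof.
rewrite cond_expectE sumr_const card_Sym -[X in _ * X]mulr_natl mulrA.
rewrite mulVf ?mul1r //.
by rewrite pnatr_eq0 -lt0n fact_gt0.
Qed.

Lemma cond_expect_tower C A f s : C \subset A ->
  cond_expect A (cond_expect C f) s = cond_expect A f s.
Proof.
move=> CA; rewrite -[RHS](cond_expect_const C _ s) !cond_expectE.
under [in LHS]eq_bigr do rewrite cond_expectE.
rewrite -mulr_sumr mulrCA exchange_big /= -mulr_sumr; congr (_ * (_ * _)).
apply: eq_bigr => q /(subsetP (subset_Sym CA)) qA.
rewrite [RHS](reindex_inj (mulgI q)); apply: eq_big => p /=.
  by rewrite groupMl.
by rewrite mulgA.
Qed.

Lemma eq_expect f u : f =1 u -> expect f = expect u.
Proof. by move=> E; apply: eq_bigr => s _; rewrite E. Qed.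

Lemma expect_shift f p : expect (fun s => f (p * s)%g) = expect f.
Proof. by rewrite /expect [RHS](reindex_inj (mulgI p)). Qed.

Lemma ler_expect f u : (forall s, f s <= u s) -> expect f <= expect u.
Proof.
move=> H; apply: ler_sum => s _; apply: ler_wpM2l => //.
by rewrite invr_ge0 ler0n.
Qed.

Lemma expectB f u : expect (fun s => f s - u s) = expect f - expect u.
Proof. by rewrite /expect -sumrB; apply: eq_bigr => s _; rewrite mulrBr. Qed.

Lemma expect_sum (J : finType) (P : pred J) (F : J -> 'S_n -> R) :
  expect (fun s => \sum_(j | P j) F j s) = \sum_(j | P j) expect (F j).
Proof.
by rewrite /expect exchange_big; apply: eq_bigr => s _; rewrite mulr_sumr.
Qed.

Lemma expectZ (k : R) f : expect (fun s => k * f s) = k * expect f.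
Proof. by rewrite /expect mulr_sumr; apply: eq_bigr => s _; rewrite mulrCA. Qed.

(** A weight [w] that only depends on the coordinates outside [A] can be taken
    out of the conditional expectation. *)
Lemma expect_mul_cond_expect A w u :
  (forall q s, q \in Sym A -> w (q * s)%g = w s) ->
  expect (fun s => cond_expect A u s * w s) = expect (fun s => u s * w s).
Proof.
move=> winv.
rewrite (@eq_expect _ (fun s => (#|A|)`!%:R^-1 *
    \sum_(p in Sym A) u (p * s)%g * w (p * s)%g)); last first.
  move=> s; rewrite cond_expectE -mulrA mulr_suml; congr (_ * _).
  by apply: eq_bigr => p pA; rewrite winv.
rewrite expectZ expect_sum.
under eq_bigr do rewrite (expect_shift (fun s => u s * w s)).
rewrite sumr_const card_Sym -[X in _ * X]mulr_natl mulrA mulVf ?mul1r //.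
by rewrite pnatr_eq0 -lt0n fact_gt0.
Qed.

Lemma expect_cond_expect A f : expect (cond_expect A f) = expect f.
Proof.
have := @expect_mul_cond_expect A (fun=> 1) f (fun _ _ _ => erefl).
rewrite (@eq_expect _ (cond_expect A f)) => [->|s]; last by rewrite mulr1.
by apply: eq_expect => s; rewrite mulr1.
Qed.

Lemma tperm_Sym A l k : l \in A -> k \in A -> tperm l k \in Sym A.
Proof.
move=> lA kA; rewrite inE; apply: (subset_trans (tperm_on l k)).
by rewrite subUset !sub1set lA kA.
Qed.

Lemma mem_SymD1 A l p : (p \in Sym (A :\ l)) = (p \in Sym A) && (p l == l).
Proof.
rewrite !inE; apply/subsetP/andP => [H|[/subsetP H pl] i].
  split; last first.
    by apply: contraT => pl; have := H l; rewrite !inE eqxx => /(_ pl).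
  by apply/subsetP => i /H; rewrite !inE => /andP[].
move=> pi; rewrite !inE (H i pi) andbT.
by apply: contraTneq pi => ->; rewrite inE pl.
Qed.

(** Split the average over the permutations of [A] according to the position [l]
    that receives the value [s k]; [tperm l k * s] is the representative of the
    atom of [s] that does so, and the positions are equally likely. *)
Lemma cond_expect_split A k f s : k \in A ->
  #|A|%:R * cond_expect A f s =
  \sum_(l in A) cond_expect (A :\ l) f (tperm l k * s)%g.
Proof.
move=> kA; rewrite cond_expectE.
rewrite (partition_big (fun p : 'S_n => (p^-1)%g k) (fun l => l \in A)) /=;
  last first.
  by move=> p; rewrite -groupV inE => /perm_closed ->.
rewrite !mulr_sumr; apply: eq_bigr => l lA.
have cA : #|A| = #|A :\ l|.+1 by rewrite (cardsD1 l A) lA.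
rewrite cond_expectE mulrA {1 2}cA factS natrM invfM mulrA.
rewrite divff ?mul1r ?pnatr_eq0 //; congr (_ * _).
rewrite (reindex_inj (mulIg (tperm l k))); apply: eq_big => p /=; last first.
  by rewrite mulgA.
rewrite mem_SymD1 groupMr ?tperm_Sym //; congr (_ && _).
rewrite (can2_eq (permKV _) (permK _)) permM eq_sym.
by rewrite (can2_eq (tpermK l k) (tpermK l k)) tpermR.
Qed.

(** Conjugation by [tperm l k] exchanges the permutations of [B] fixing [k] with
    those fixing [l]. *)
Lemma cond_expect_conj B k l u s : k \in B -> l \in B ->
  cond_expect (B :\ k) (fun t => u (tperm l k * t)%g) s
  = cond_expect (B :\ l) u (tperm l k * s)%g.
Proof.
move=> kB lB; rewrite !cond_expectE.
have -> : #|B :\ k| = #|B :\ l|.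
  by have := cardsD1 k B; rewrite (cardsD1 l B) kB lB => /addnI.
congr (_ * _); rewrite (reindex_inj (conjg_inj (tperm l k))).
apply: eq_big => p /=.
  rewrite !mem_SymD1 groupJr ?tperm_Sym //; congr (_ && _).
  rewrite /conjg tpermV !permM tpermR (can2_eq (tpermK l k) (tpermK l k)).
  by rewrite tpermR.
by move=> _; rewrite /conjg tpermV !mulgA tperm2 mul1g.
Qed.

(** Given the configuration outside [B], the conditional expectation on
    [B :\ l] depends on a configuration only through its value at [l]. *)
Lemma cond_expectD1_eq B l f p q s : l \in B -> p \in Sym B -> q \in Sym B ->
  p l = q l ->
  cond_expect (B :\ l) f (p * s)%g = cond_expect (B :\ l) f (q * s)%g.
Proof.
move=> lB pB qB pql; rewrite -(@cond_expect_shift _ _ (q * p^-1)%g (p * s)%g).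
  by rewrite mulgA mulgKV.
by rewrite mem_SymD1 groupM ?groupV //= permM -pql permK.
Qed.

Definition block_ent A f : R := expect (cond_ent A f).

(** Since the first term does not depend on [A], differences of block entropies
    are differences of the second term only. *)
Lemma block_entE A f : block_ent A f =
  expect (fun s => xlnx (f s)) - expect (fun s => xlnx (cond_expect A f s)).
Proof. by rewrite /block_ent /cond_ent expectB expect_cond_expect. Qed.

(** The conditional mean of [f] given the coordinates of [s] outside [A] and the
    event that position [l] carries the value [s k].  The value is named by its
    position [k] in [s]; seen as a function of [l], the profile is the
    one-function object to which [set_ent] applies. *)
Definition profile A k f s l : R := cond_expect (A :\ l) f (tperm l k * s)%g.

Lemma avg_profile A k f s :
  k \in A -> avg A (profile A k f s) = cond_expect A f s.
Proof.
move=> kA; have A0 : A != set0 by apply/set0Pn; exists k.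
by rewrite /avg -cond_expect_split // mulrAC divff ?mul1r // gt_eqF ?card_gt0R.
Qed.

(** The left side compares conditional means at the position [l] of a fixed
    configuration; shifting [s] by [tperm l k], which preserves the uniform law,
    makes them the entries at [l] of a single profile, that of the value [s k],
    and the mean of this profile is the conditional mean on [A]. *)
Lemma block_ent_chain A k f : k \in A ->
  \sum_(l in A) (block_ent A f - block_ent (A :\ l) f) =
  expect (fun s => set_ent A (profile A k f s)).
Proof.
move=> kA; rewrite /set_ent expectB expect_sum.
under eq_expect do rewrite avg_profile //.
rewrite expectZ mulr_natl -sumr_const -sumrB; apply: eq_bigr => l lA.
rewrite (expect_shift (fun s => xlnx (cond_expect (A :\ l) f s))) !block_entE.
ring.
Qed.

Lemma profile_gt0 A k f s l : (forall t, 0 < f t) -> 0 < profile A k f s l.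
Proof. exact: cond_expect_gt0. Qed.

(** Averaging the profile of a block over what happens in a larger block, with
    the value [s k] held fixed, gives the profile of the larger block. *)
Lemma cond_expect_profile A B k f s l : A \subset B -> k \in A -> l \in A ->
  cond_expect (B :\ k) (fun t => profile A k f t l) s = profile B k f s l.
Proof.
move=> AB kA lA; rewrite /profile (cond_expect_conj (cond_expect (A :\ l) f)).
- by rewrite cond_expect_tower // setSD.
- exact: (subsetP AB).
- exact: (subsetP AB).
Qed.

(** Jensen's inequality for [set_ent A].  The tangent inequality at the profile
    of [B] is used; its coefficients do not change under permutations of
    [B :\ k], so in the linear bound the profile of [A] may be replaced by its
    conditional mean, the profile of [B]. *)
Lemma set_ent_profile_le A B k f :
  (forall t, 0 < f t) -> A \subset B -> k \in A ->
  expect (fun s => set_ent A (profile B k f s)) <=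
  expect (fun s => set_ent A (profile A k f s)).
Proof.
move=> f0 AB kA; have A0 : A != set0 by apply/set0Pn; exists k.
pose w l s := ln (profile B k f s l) - ln (avg A (profile B k f s)).
have profinv q s l : l \in A -> q \in Sym (B :\ k) ->
    profile B k f (q * s)%g l = profile B k f s l.
  by move=> lA qB; rewrite -!(@cond_expect_profile A) // cond_expect_shift.
have winv l q s : l \in A -> q \in Sym (B :\ k) -> w l (q * s)%g = w l s.
  move=> lA qB; rewrite /w profinv // /avg.
  by under eq_bigr do rewrite profinv //.
apply: (@le_trans _ _
  (expect (fun s => \sum_(l in A) profile A k f s l * w l s))).
  rewrite expect_sum (eq_expect (fun s => set_entE _ A0)) expect_sum.
  apply: ler_sum => l lA.
  rewrite -(@expect_mul_cond_expect (B :\ k) (w l)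
    (fun t => profile A k f t l)).
    by apply: ler_expect => s; rewrite cond_expect_profile.
  by move=> q s; apply: winv.
apply: ler_expect => s; apply: set_ent_tangent => // l; exact: profile_gt0.
Qed.

(** Given the outside of [B], the values at two positions of [B] have the same
    law.  This lets blocks [A] that do not contain a common position refer to
    the same value. *)
Lemma expect_profile_base A B k k0 f : A \subset B -> k \in B -> k0 \in B ->
  expect (fun s => set_ent A (profile B k f s)) =
  expect (fun s => set_ent A (profile B k0 f s)).
Proof.
move=> AB kB k0B; rewrite -(expect_shift _ (tperm k k0)).
apply: eq_expect => s; apply: eq_set_ent => l /(subsetP AB) lB.
rewrite /profile mulgA; apply: cond_expectD1_eq => //.
- by rewrite groupM ?tperm_Sym.
- exact: tperm_Sym.
- by rewrite permM !tpermL.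
Qed.

(** Induction on #|B|.  Summing U(A) over l in B, where U is [block_ent ^~ f],
    gives the sum of the U(A :\ l) plus V(A), for every A contained in B,
    because the terms with l outside A agree.  The first part is handled by
    induction, the second by [set_ent_block] applied to the profile of [B]. *)
Lemma block_ent_factorization_gt0 (c : R) (theta : {set 'I_n} -> R) f B :
  (forall A, 0 <= theta A) ->
  (forall i j, i != j -> c <= pair_weight theta i j) ->
  (forall s, 0 < f s) ->
  c * block_ent B f <= \sum_A theta A * block_ent (A :&: B) f.
Proof.
move=> t0 ct f0; have [m] := ubnP #|B|; elim: m => // m IH in B *.
rewrite ltnS => Bm; have [->|[k0 k0B]] := set_0Vmem B.
  have E0 : block_ent set0 f = 0.
    rewrite block_entE -[RHS](subrr (expect (fun s => xlnx (f s)))).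
    congr (_ - _); apply: eq_expect => s.
    rewrite cond_expectE cards0 fact0 invr1 mul1r.
    have -> : Sym (set0 : {set 'I_n}) = [set 1%g].
      by apply/esym/eqP; rewrite eqEcard sub1set group1 card_Sym cards0 cards1.
    by rewrite big_set1 mul1g.
  by rewrite E0 mulr0 big1 // => A _; rewrite setI0 E0 mulr0.
pose V A := \sum_(l in A) (block_ent A f - block_ent (A :\ l) f).
pose H A := expect (fun s => set_ent A (profile B k0 f s)).
have VH A : A \subset B -> H A <= V A.
  move=> AB; have [->|[k kA]] := set_0Vmem A.
    rewrite /V big_set0 /H /expect big1 // => s _.
    by rewrite set_ent0 mulr0.
  rewrite /V (block_ent_chain f kA) /H.
  rewrite (@expect_profile_base A B k0 k) //; last exact: (subsetP AB).
  exact: set_ent_profile_le.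
have HB : V B = H B by rewrite /V (block_ent_chain f k0B).
have cH : c * H B <= \sum_A theta A * H (A :&: B).
  rewrite -expectZ; under [leRHS]eq_bigr do rewrite -expectZ.
  rewrite -expect_sum; apply: ler_expect => s.
  by apply: set_ent_block => // l; apply: profile_gt0.
have VE A : A \subset B ->
    #|B|%:R * block_ent A f = \sum_(l in B) block_ent (A :\ l) f + V A.
  move=> AB; rewrite mulr_natl -sumr_const /V.
  rewrite [in RHS](big_setID A) (setIidPr AB).
  rewrite [LHS](big_setID A) (setIidPr AB) /=.
  rewrite addrAC -big_split /=; congr (_ + _).
    by apply: eq_bigr => l _; rewrite subrKC.
  apply: eq_bigr => l; rewrite inE => /andP[lA _].
  by rewrite (setDidPl _) // disjoint_sym disjoints1.
have B0 : 0 < #|B|%:R :> R by rewrite card_gt0R //; apply/set0Pn; exists k0.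
rewrite -(ler_pM2l B0) mulrCA VE // mulrDr HB [leRHS]mulr_sumr.
have -> : \sum_A #|B|%:R * (theta A * block_ent (A :&: B) f) =
   \sum_(l in B) \sum_A theta A * block_ent (A :&: (B :\ l)) f
   + \sum_A theta A * V (A :&: B).
  rewrite exchange_big -big_split /=; apply: eq_bigr => A _.
  rewrite mulrCA VE ?subsetIr // mulrDr mulr_sumr; congr (_ + _).
  by apply: eq_bigr => l _; rewrite setIDA.
apply: lerD.
  rewrite mulr_sumr; apply: ler_sum => l lB; apply: IH.
  by apply: leq_trans Bm; rewrite [leqRHS](cardsD1 l) lB.
apply: (le_trans cH); apply: ler_sum => A _.
by rewrite ler_wpM2l // VH // subsetIr.
Qed.

End Permutations.

(** * Removing the positivity assumption *)

Section Limit.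
Variables (R : realType) (n : nat).
Implicit Types (f : 'S_n -> R) (A : {set 'I_n}).

Lemma cond_expectDc A f e s :
  cond_expect A (fun t => f t + e) s = cond_expect A f s + e.
Proof.
rewrite -[X in _ = _ + X](@cond_expect_const R n A e s) !cond_expectE.
by rewrite -mulrDr -big_split.
Qed.

Lemma continuous_expect (F : 'S_n -> R -> R) :
  (forall s, continuous (F s)) -> continuous (fun e => expect (F^~ e)).
Proof.
move=> cF x; apply: cvg_big => [|s _]; first exact: add_continuous.
apply: cvgM; first exact: cvg_cst.
exact: cF.
Qed.

Lemma continuous_block_ent_shift A f :
  continuous (fun e => block_ent A (fun s => f s + e)).
Proof.
have cx (a : R) : continuous (fun e => xlnx (a + e)).
  move=> x; apply: (@continuous_comp _ _ _ (fun e => a + e) (@xlnx R)).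
    by apply: cvgD; [exact: cvg_cst|exact: cvg_id].
  exact: continuous_xlnx.
have -> : (fun e => block_ent A (fun s => f s + e)) =
   (fun e => expect (fun s => xlnx (f s + e))
             - expect (fun s => xlnx (cond_expect A f s + e))).
  apply/funext => e; rewrite block_entE; congr (_ - _).
  by apply: eq_expect => s; rewrite cond_expectDc.
move=> x; apply: cvgB.
- exact: (@continuous_expect (fun s e => xlnx (f s + e))).
- exact: (@continuous_expect (fun s e => xlnx (cond_expect A f s + e))).
Qed.

Lemma block_ent_factorization (c : R) (theta : {set 'I_n} -> R) f B :
  (forall A, 0 <= theta A) ->
  (forall i j, i != j -> c <= pair_weight theta i j) ->
  (forall s, 0 <= f s) ->
  c * block_ent B f <= \sum_A theta A * block_ent (A :&: B) f.
Proof.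
move=> t0 ct f0.
pose gap e := \sum_A theta A * block_ent (A :&: B) (fun s => f s + e)
              - c * block_ent B (fun s => f s + e).
have gap0 : gap 0 = \sum_A theta A * block_ent (A :&: B) f - c * block_ent B f.
  have E : (fun s => f s + 0) = f by apply/funext => s; rewrite addr0.
  by rewrite /gap E.
have cgap : continuous gap.
  move=> x; apply: cvgB.
    apply: cvg_big => [|A _]; first exact: add_continuous.
    apply: cvgM; first exact: cvg_cst.
    exact: continuous_block_ent_shift.
  by apply: cvgM; [exact: cvg_cst|exact: continuous_block_ent_shift].
rewrite -subr_ge0 -gap0.
have lim0 := cvg_at_right_filter (cgap 0).
rewrite -(cvg_lim _ lim0) //.
apply: limr_ge; first by apply/cvg_ex; exists (gap 0).
near=> e; rewrite subr_ge0; apply: block_ent_factorization_gt0 => // s.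
by apply: ltr_wpDl => //; near: e; exact: nbhs_right_gt.
Unshelve. all: by end_near. Qed.

Lemma theta_star_star_le (theta : {set 'I_n} -> R) (i j : 'I_n) :
  i != j -> theta_star_star theta <= pair_weight theta i j.
Proof.
have lt_case (k l : 'I_n) :
    (k < l)%N -> theta_star_star theta <= pair_weight theta k l.
  by move=> kl; apply: (@bigmin_le_cond _ _ _ _ (k, l)).
rewrite neq_ltn => /orP[/lt_case //|/lt_case].
by rewrite /pair_weight; under eq_bigl do rewrite setUC.
Qed.

(** There is a single atom when no coordinate is fixed. *)
Lemma ent_setT f : ent f = block_ent setT f.
Proof.
have mass1 : unif_prob R [set: 'S_n] = 1.
  rewrite /unif_prob /unif_mass sumr_const -[LHS]mulr_natr cardsT mulVf //.
  by rewrite pnatr_eq0 -lt0n; apply/card_gt0P; exists 1%g.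
have E (g : 'S_n -> R) s : cond_expect setT g s = expect g.
  have -> : cond_expect setT g s =
     (\sum_(t in [set: 'S_n]) unif_mass R t * g t) / unif_prob R [set: 'S_n].
    have -> : [set: 'S_n] = atom setT s; last by [].
    by apply/setP => t; rewrite !inE; apply/esym/forall_inP => i; rewrite !inE.
  by rewrite mass1 divr1 /expect; apply: eq_bigl => t; rewrite inE.
rewrite block_entE /ent; congr (_ - _).
rewrite [RHS](@eq_expect R n _ (fun=> xlnx (expect f))) => [|s]; last first.
  by rewrite E.
by rewrite -[RHS](E _ 1%g) cond_expect_const.
Qed.
End Limit.

Theorem theorem4 (R : realType) (n : nat) (hn : (2 <= n)%N)
    (theta : {set 'I_n} -> R) (htheta : probability_vector theta)
    (f : 'S_n -> R) (hf : forall s : 'S_n, 0 <= f s) :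
  theta_star_star theta * ent f
    <= \sum_(A : {set 'I_n}) theta A * expect (cond_ent A f).
Proof.
have [theta_ge0 _] := htheta.
rewrite ent_setT.
have := block_ent_factorization setT theta_ge0
  (@theta_star_star_le R n theta) hf.
by under eq_bigr do rewrite setIT.
Qed.
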